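(* Let $N,K,L,T$ be positive integers with $N\ge K+1$, and let $\tau\in\{0,1,\dots,L-1\}$ be an integer timing offset and $\delta_f\in\mathbb{R}$ a (normalized) carrier frequency offset. Consider the noiseless received signal $$\boldsymbol{y}(t)=e^{j2\pi\delta_f t}\,\boldsymbol{h}\,s(t-\tau)+\sum_{k=1}^{K}\boldsymbol{g}_k\, i_k(t)\in\mathbb{C}^N,\qquad t\in\mathbb{Z},$$ where $\boldsymbol{h},\boldsymbol{g}_1,\dots,\boldsymbol{g}_K\in\mathbb{C}^N$ are linearly independent (deterministic, unknown) vectors, and the scalar sequences $s(t)$ and $i_1(t),\dots,i_K(t)$ are random processes that are statistically independent of one another. The values $s(1),\dots,s(T)$ (the preamble) are known to the receiver. For $\omega\in\mathbb{R}$ and $\boldsymbol{w}=[\boldsymbol{w}_0^H,\dots,\boldsymbol{w}_{L-1}^H]^H\in\mathbb{C}^{NL}$ (each $\boldsymbol{w}_l\in\mathbb{C}^N$) define $$F(\omega,\boldsymbol{w})=\sum_{t=1}^{T}\Big|s(t)-\sum_{l=0}^{L-1}e^{-j2\pi\omega(t+l)}\boldsymbol{w}_l^H\boldsymbol{y}(t+l)\Big|^2 .$$ Let $\Omega\subset\mathbb{R}$ be a search set containing $\delta_f$ such that no two distinct elements of $\Omega$ differ by an integer. If $T>(K+1)L$, then with probability one the minimum of $F$ over $\Omega\times\mathbb{C}^{NL}$ equals $0$, and every pair $(\omega^\star,\boldsymbol{w}^\star)\in\Omega\times\mathbb{C}^{NL}$ with $F(\omega^\star,\boldsymbol{w}^\star)=0$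 satisfies $\omega^\star=\delta_f$ and $\boldsymbol{w}^\star\in\mathcal{C}$, where $$\mathcal{C}=\Big\{\boldsymbol{w}=(\boldsymbol{w}_l)_{l=0}^{L-1}:\ \boldsymbol{h}^H\boldsymbol{w}_\tau=1,\ \boldsymbol{h}^H\boldsymbol{w}_l=0\ \forall l\ne\tau,\ \boldsymbol{g}_k^H\boldsymbol{w}_l=0\ \forall l\in\{0,\dots,L-1\},\ \forall k\in\{1,\dots,K\}\Big\}.$$
   Context: Setting: a single-antenna transmitter sends a digitally modulated baseband signal $s(t)$ to an $N$-antenna receiver in the presence of $K$ jamming signals $i_k(t)$; time $t$ is measured in sampling intervals. $(\cdot)^H$ denotes conjugate transpose. Equivalently, with $\vec{\boldsymbol{y}}_\omega(t)=[e^{j2\pi\omega t}\boldsymbol{y}^H(t),\dots,e^{j2\pi\omega(t+L-1)}\boldsymbol{y}^H(t+L-1)]^H\in\mathbb{C}^{NL}$, $\boldsymbol{A}_\omega\in\mathbb{C}^{T\times NL}$ the matrix whose $t$-th row is $\vec{\boldsymbol{y}}_\omega^H(t)$, and $\tilde{\boldsymbol{s}}=[s(1),\dots,s(T)]^H$, one has $F(\omega,\boldsymbol{w})=\|\tilde{\boldsymbol{s}}-\boldsymbol{A}_\omega\boldsymbol{w}\|_2^2$. The values $s(t)$ for $t\le 0$ or $t>T$ are unknown data symbols (also random, independent of the jammers). The randomness assumption is used in the sense that the signal samples are generic (e.g., the signals have jointly continuous distributions), so that ''with probability one'' statements about full-rank data matrices apply. A filter $\boldsymbol{w}\in\mathcal{C}$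 used with $\omega=\delta_f$ outputs exactly $s(t)$ in the noiseless case, i.e. it cancels all jammers and compensates the timing and frequency offsets. *)

(* Defs.v *)
From mathcomp Require Import all_boot all_algebra.
From mathcomp Require Import all_classical all_reals all_analysis.
From mathcomp.real_closed Require Import complex.
Set Implicit Arguments. Unset Strict Implicit. Unset Printing Implicit Defensive.
Import GRing.Theory Num.Theory.
Local Open Scope ring_scope.
Local Open Scope complex_scope.

Section Defs.
Variable R : realType.
Local Notation C := R[i].

Definition expi (th : R) : C := cos th +i* sin th.

Definition cabs2 (z : C) : R := complex.Re z ^+ 2 + complex.Im z ^+ 2.

Definition dotH (n : nat) (u v : 'cV[C]_n) : C :=
  ((map_mx conjc u)^T *m v) 0 0.

(* Lebesgue-null subset of C^I (identified with R^(2 #|I|)):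
   for every e > 0 it can be covered by countably many cubes (side 2 r_n in
   each of the 2 #|I| real coordinates) of total volume <= e. *)
Definition lebesgue_null (I : finType) (Z : set (I -> C)) : Prop :=
  forall e : R, 0 < e ->
  exists (c : nat -> I -> C) (r : nat -> R),
    (forall n, 0 < r n) /\
    (forall x, Z x -> exists n, forall i,
        `|complex.Re (x i - c n i)| <= r n /\ `|complex.Im (x i - c n i)| <= r n) /\
    (forall m, \sum_(n < m) (r n *+ 2) ^+ (2 * #|I|) <= e).

Definition rx_signal (N K : nat) (tau : nat) (df : R) (h : 'cV[C]_N)
    (g : 'I_K -> 'cV[C]_N) (s : int -> C) (ii : 'I_K -> int -> C) (t : int)
    : 'cV[C]_N :=
  (expi (2 * pi * df * t%:~R) * s (t - tau%:Z)) *: h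
  + \sum_(k < K) ii k t *: g k.

Definition costF (N L T : nat) (s : int -> C) (y : int -> 'cV[C]_N)
    (om : R) (w : 'I_L -> 'cV[C]_N) : R :=
  \sum_(t < T)
    cabs2 (s (t.+1 : int)
           - \sum_(l < L) expi (- (2 * pi * om * ((t.+1 + l)%N : int)%:~R))
                           * dotH (w l) (y ((t.+1 + l)%N : int))).

Definition good_filters (N K L : nat) (tau : nat) (h : 'cV[C]_N)
    (g : 'I_K -> 'cV[C]_N) (w : 'I_L -> 'cV[C]_N) : Prop :=
  (forall l : 'I_L, val l = tau -> dotH h (w l) = 1) /\
  (forall l : 'I_L, val l <> tau -> dotH h (w l) = 0) /\
  (forall (k : 'I_K) (l : 'I_L), dotH (g k) (w l) = 0).

(* The finitely many samples entering the problem: s(t) for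
   t = 1 - tau, ..., T + L - 1 - tau  (this window contains the preamble
   s(1..T)) and i_k(t) for t = 1, ..., T + L - 1. *)
Definition sample_vector (K L T : nat) (tau : nat) (s : int -> C)
    (ii : 'I_K -> int -> C) : ('I_(T + L - 1) + ('I_K * 'I_(T + L - 1)))%type -> C :=
  fun x => match x with
           | inl j => s ((val j).+1%:Z - tau%:Z)
           | inr kj => ii kj.1 ((val kj.2).+1%:Z)
           end.

End Defs.

(* Main.v *)
Require Import Defs.
From mathcomp Require Import all_boot all_algebra.
From mathcomp Require Import all_classical all_reals all_analysis.
From mathcomp.real_closed Require Import complex.
From mathcomp Require Import order perm ring lra zify.
Import Order.TTheory GRing.Theory Num.Theory numFieldNormedType.Exports.
Set Implicit Arguments.
Unset Strict Implicit.
Unset Printing Implicit Defensive.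
Local Open Scope ring_scope.
Local Open Scope complex_scope.

(* With [a_l = w_l^H h], [b_kl = w_l^H g_k] and [u = exp(j 2 pi (df - om))], zero
   cost is a linear system in [a] and [b], one equation per preamble symbol.
   Clearing denominators makes [(a - e_tau, b, u - 1)], up to powers of [u], a kernel
   vector of a matrix of samples whose extra column is
   [s(t) (u^t - u^tau) / (u - 1)].  If this matrix has full column rank for every
   [om], then [u = 1], [a = e_tau] and [b = 0].

   Full rank is a property of the samples that must hold for uncountably many [om]
   at once.  A square submatrix can be ordered so that each pivot carries a
   sample occurring nowhere else among the rows and columns still present.  Hence
   each successive minor [D_m+1] is affine in that complex sample with slope a unit
   times [D_m]; on the locus [D_m+1 = 0], [D_m <> 0] the sample is a locally Lipschitz
   function of [om] and the other samples.  Two real dimensions are traded for one,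
   so this locus is null even after taking the union over all real [om]. *)

(** * Null sets *)

Lemma sum_half_pow_le1 (R : realType) (n : nat) :
  \sum_(k < n) (2^-1 : R) ^+ k.+1 <= 1.
Proof.
suff -> : \sum_(k < n) (2^-1 : R) ^+ k.+1 = 1 - 2^-1 ^+ n.
  by rewrite gerBl exprn_ge0 // invr_ge0.
elim: n => [|n IHn]; first by rewrite big_ord0 expr0 subrr.
by rewrite big_ord_recr /= IHn exprS; lra.
Qed.

Lemma ler_sum_uniq_sub (R : realType) (F : eqType) (S S' : seq F) (f : F -> R) :
  (forall x, 0 <= f x) -> uniq S -> uniq S' -> {subset S <= S'} ->
  \sum_(x <- S) f x <= \sum_(x <- S') f x.
Proof.
move=> f0 uS uS' SS'.
rewrite [leRHS](bigID (mem S)) /= -[leLHS]addr0 lerD ?sumr_ge0//.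
rewrite -[leRHS]big_filter (perm_big [seq x <- S' | x \in S])//.
apply: uniq_perm => //; first exact: filter_uniq.
by move=> x; rewrite mem_filter; apply/idP/andP => [xS|[]//]; split=> //; apply: SS'.
Qed.

(* Indices of a sequence that do not encode an element of [F] receive padding
   cubes of total volume at most [e / 2]. *)
Lemma lebesgue_null_countable_cover (R : realType) (I : finType) (Z : set (I -> R[i])) :
  (0 < #|I|)%N ->
  (forall e : R, 0 < e ->
    exists (F : countType) (c : F -> I -> R[i]) (r : F -> R),
      [/\ forall f, 0 < r f,
          forall x, Z x -> exists f, forall i,
            `|complex.Re (x i - c f i)| <= r f /\ `|complex.Im (x i - c f i)| <= r f
        & forall S : seq F, uniq S -> \sum_(f <- S) (r f *+ 2) ^+ (2 * #|I|) <= e]) ->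
  lebesgue_null Z.
Proof.
move=> I0 H e e0.
have e20 : 0 < e / 2 by rewrite divr_gt0.
have [F [c [r [r0 Zc Sr]]]] := H _ e20.
(* The cap at [1] makes the volume [pad n ^+ (2 * #|I|)] at most [pad n], the exponent being
   positive. *)
pose pad (n : nat) : R := Num.min 1 ((e / 2) * 2^-1 ^+ n.+1).
have pad0 n : 0 < pad n by rewrite lt_min ltr01 mulr_gt0// exprn_gt0// invr_gt0.
pose d (n : nat) : option F := pickle_inv n.
pose r' n := if d n is Some f then r f else pad n / 2.
exists (fun n => if d n is Some f then c f else fun=> 0), r'.
split; [|split].
- by move=> n; rewrite /r'; case: (d n) => // ; rewrite divr_gt0.
- move=> x /Zc [f Hf]; exists (pickle f).
  have -> : d (pickle f) = Some f by rewrite /d pickleK_inv.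
  by move=> i; rewrite /r' /d pickleK_inv; exact: Hf.
- move=> m; pose v (x : R) := (x *+ 2) ^+ (2 * #|I|).
  have v0 x : 0 <= x -> 0 <= v x by move=> x0; rewrite exprn_ge0// mulrn_wge0.
  have -> : \sum_(n < m) (r' n *+ 2) ^+ (2 * #|I|) =
            \sum_(n <- iota 0 m) v (r' n).
    by rewrite -[m in iota 0 m]subn0 -/(index_iota 0 m) big_mkord.
  have : \sum_(n <- iota 0 m) v (r' n) <=
         \sum_(f <- pmap d (iota 0 m)) v (r f) + \sum_(n <- iota 0 m) pad n.
    elim: (iota 0 m) => [|n s IHs]; first by rewrite !big_nil addr0.
    rewrite /= !big_cons /r'; case: (d n) => [f|] /=.
      by rewrite big_cons -addrA lerD2l (le_trans IHs)// lerD2l lerDr ltW.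
    have -> : v (pad n / 2) = pad n ^+ (2 * #|I|).
      by rewrite /v -[_ *+ 2]mulr_natr divfK ?pnatr_eq0.
    rewrite addrCA lerD//.
    have p1 : pad n <= 1 by rewrite ge_min lexx.
    by rewrite -[leRHS]expr1; apply: ler_wiXn2l; rewrite ?muln_gt0// ltW.
  move=> /le_trans; apply; rewrite [leRHS](splitr e) lerD//.
    by apply: Sr; apply: pmap_uniq (iota_uniq 0 m); apply: pickle_invK.
  rewrite -[m in iota 0 m]subn0 -/(index_iota 0 m) big_mkord.
  apply: (@le_trans _ _ (\sum_(n < m) (e / 2) * 2^-1 ^+ n.+1)).
    by apply: ler_sum => n _; rewrite ge_min lexx orbT.
  by rewrite -mulr_sumr ler_piMr ?sum_half_pow_le1// ltW.
Qed.

Lemma lebesgue_null_bigcup (R : realType) (I : finType) (Z : nat -> set (I -> R[i])) :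
  (0 < #|I|)%N -> (forall k, lebesgue_null (Z k)) ->
  lebesgue_null (\bigcup_k Z k)%classic.
Proof.
move=> I0 HZ; apply: lebesgue_null_countable_cover => // e e0.
have ek k : 0 < e * 2^-1 ^+ k.+1 by rewrite mulr_gt0// exprn_gt0// invr_gt0.
have /choice [c /choice [r H]] := fun k => HZ k _ (ek k).
exists (nat * nat)%type, (fun f => c f.1 f.2), (fun f => r f.1 f.2); split.
- by move=> f; have [+ _] := H f.1; exact.
- by move=> x [k _ /(H k).2.1 [n Hn]]; exists (k, n).
move=> S uS; pose v f := (r f.1 f.2 *+ 2) ^+ (2 * #|I|).
have v0 f : 0 <= v f.
  by rewrite exprn_ge0// mulrn_wge0// ltW//; have [+ _] := H f.1; exact.
(* A finite set of pairs lies in a square, whose rows are summed against the budgets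
   [e * 2^-1 ^+ k.+1]. *)
have [A SA] : exists A, forall f, f \in S -> (f.1 < A)%N && (f.2 < A)%N.
  exists (\max_(f <- S) maxn f.1 f.2).+1 => f fS; rewrite !ltnS -geq_max.
  exact: (@leq_bigmax_seq _ S xpredT (fun f : nat * nat => maxn f.1 f.2)).
apply: (@le_trans _ _ (\sum_(f <- [seq (k, n) | k <- iota 0 A, n <- iota 0 A]) v f)).
  apply: ler_sum_uniq_sub => //.
    by apply: allpairs_uniq; rewrite ?iota_uniq// => -[? ?] [? ?].
  move=> [k n] /SA/andP[/= kA nA]; apply/allpairsP; exists (k, n).
  by rewrite !mem_iota/= !add0n.
rewrite big_allpairs /=.
apply: (@le_trans _ _ (\sum_(k <- iota 0 A) e * 2^-1 ^+ k.+1)).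
  apply: ler_sum => k _; rewrite -[A in iota 0 A]subn0 -/(index_iota 0 A) big_mkord.
  by have [_ [_]] := H k; apply.
rewrite -[A in iota 0 A]subn0 -/(index_iota 0 A) big_mkord -mulr_sumr.
by rewrite ler_piMr ?sum_half_pow_le1// ltW.
Qed.

Lemma lebesgue_null_sub (R : realType) (I : finType) (Z Z' : set (I -> R[i])) :
  (Z `<=` Z')%classic -> lebesgue_null Z' -> lebesgue_null Z.
Proof.
move=> ZZ' H e /H [c [r [r0 [Hc Hs]]]]; exists c, r; split=> //; split=> //.
by move=> x /ZZ'/Hc.
Qed.

Lemma lebesgue_nullU (R : realType) (I : finType) (Z Z' : set (I -> R[i])) :
  (0 < #|I|)%N -> lebesgue_null Z -> lebesgue_null Z' ->
  lebesgue_null (Z `|` Z')%classic.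
Proof.
move=> I0 nZ nZ'.
apply: (@lebesgue_null_sub _ _ _ (\bigcup_k (if k == 0%N then Z else Z'))%classic).
  by move=> x [Zx|Zx]; [exists 0%N|exists 1%N].
by apply: lebesgue_null_bigcup => // k; case: ifP.
Qed.

(* [phi] maps [Z] into a bounded part of a space of lower real dimension and has
   a Lipschitz inverse: a grid of mesh [1 / m] downstairs gives [O(m ^ #|J|)]
   cubes of side [O(1 / m)] upstairs. *)
Lemma lebesgue_null_lipschitz_image (R : realType) (I J : finType) (Z : set (I -> R[i]))
  (phi : (I -> R[i]) -> J -> R) (M : nat) (C : R) :
  (#|J| < 2 * #|I|)%N -> 0 < C ->
  (forall x p, Z x -> `|phi x p| <= M%:R) ->
  (forall x y (e : R), Z x -> Z y -> 0 <= e ->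
    (forall p, `|phi x p - phi y p| <= e) ->
    forall i, `|complex.Re (x i - y i)| <= C * e /\
              `|complex.Im (x i - y i)| <= C * e) ->
  lebesgue_null Z.
Proof.
move=> JI C0 bphi lphi.
have I0 : (0 < #|I|)%N by move: JI; case: #|I| => //; rewrite muln0.
apply: lebesgue_null_countable_cover => // e e0.
(* At most [(2M + 1)^#|J| m^#|J|] cells, each of volume [(2C / m)^(2 #|I|)], total at most [A / m]
   since [#|J| < 2 #|I|]. *)
pose A : R := (M.*2.+1%:R) ^+ #|J| * (C *+ 2) ^+ (2 * #|I|).
have A0 : 0 < A by rewrite mulr_gt0// exprn_gt0// pmulrn_lgt0.
pose m := (Num.truncn (A / e)).+1.
have m0 : 0 < m%:R :> R by rewrite ltr0n.
have Am : A / m%:R <= e.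
  by rewrite ler_pdivrMr// mulrC -ler_pdivrMr// ltW// truncnS_gt.
pose G := (M.*2 * m)%N.
pose cell x : {ffun J -> 'I_G.+1} := [ffun p => inord (Num.truncn (m%:R * (phi x p + M%:R)))].
(* Centres are points of [Z], where the Lipschitz bound applies; a cell missing [Z] gets centre [0],
   and its cube only adds volume. *)
pose rep f := xget (fun=> 0) [set x | Z x /\ cell x = f]%classic.
exists {ffun J -> 'I_G.+1}, rep, (fun=> C / m%:R); split.
- by move=> _; rewrite divr_gt0.
- move=> x Zx; exists (cell x).
  have [Zy cy] : Z (rep (cell x)) /\ cell (rep (cell x)) = cell x.
    by apply: (xgetPex _ (P := [set y | Z y /\ cell y = cell x]%classic)); exists x.
  apply: lphi => // p.
  move: Zy cy; move: (rep _) => y Zy /ffunP/(_ p); rewrite !ffunE => /(congr1 val).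
  have b z : Z z -> 0 <= m%:R * (phi z p + M%:R) /\
      (Num.truncn (m%:R * (phi z p + M%:R))%R < G.+1)%N.
    move=> /(bphi z p); rewrite ler_norml => /andP[l u].
    have z0 : 0 <= m%:R * (phi z p + M%:R) by apply: mulr_ge0; [exact: ltW|lra].
    split=> //; rewrite ltnS truncn_le_nat; apply: (@le_lt_trans _ _ (G%:R)).
      by rewrite natrM mulrC -muln2 natrM ler_wpM2r ?ler0n//; lra.
    by rewrite ltr_nat.
  have [x0 xG] := b _ Zx; have [y0 yG] := b _ Zy.
  rewrite /= !inordK// => E.
  have /andP[xl xu] := truncn_itv x0; have /andP[yl yu] := truncn_itv y0.
  rewrite E in yl yu.
  have -> : phi x p - phi y p =
     (m%:R * (phi x p + M%:R) - m%:R * (phi y p + M%:R)) / m%:R.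
    by field; rewrite gt_eqF.
  rewrite normrM [`|m%:R^-1|]gtr0_norm ?invr_gt0// -[leRHS]mul1r.
  rewrite ler_wpM2r ?invr_ge0//; move: xu yu; rewrite -natr1 => xu yu.
  by rewrite ler_norml; apply/andP; split; lra.
- move=> S uS; apply: le_trans Am.
  rewrite big_const_seq count_predT iter_addr_0.
  have sS : (size S <= G.+1 ^ #|J|)%N.
    have <- : #|{ffun J -> 'I_G.+1}| = (G.+1 ^ #|J|)%N by rewrite card_ffun card_ord.
    by rewrite -(card_uniqP uS); apply: max_card.
  apply: (@le_trans _ _ (((C / m%:R) *+ 2) ^+ (2 * #|I|) *+ (G.+1 ^ #|J|))).
    by rewrite ler_wpMn2l// exprn_ge0// mulrn_wge0// divr_ge0// ltW.
  have GM : (G.+1 ^ #|J| <= M.*2.+1 ^ #|J| * m ^ #|J|)%N.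
    rewrite -expnMn; have [->|J0] := posnP #|J|; first by rewrite !expn0.
    by rewrite leq_exp2r// mulSn -addn1 addnC leq_add2r.
  apply: (@le_trans _ _ (((C / m%:R) *+ 2) ^+ (2 * #|I|) *+ (M.*2.+1 ^ #|J| * m ^ #|J|))).
    by rewrite ler_wpMn2l// exprn_ge0// mulrn_wge0// divr_ge0// ltW.
  have key : m%:R^-1 ^+ (2 * #|I|) * m%:R ^+ #|J| <= m%:R^-1 :> R.
    rewrite -(subnKC (ltnW JI)) exprD mulrAC -exprMn mulVf ?gt_eqF// expr1n mul1r.
    by rewrite -[leRHS]expr1; apply: ler_wiXn2l; rewrite ?subn_gt0// invf_le1// ler1n.
  rewrite -mulrnAl exprMn -[leLHS]mulr_natr natrM !natrX /A.
  by rewrite mulrACA [X in X * _]mulrC; apply: ler_wpM2l; first exact: ltW.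
Qed.

(** * Locally Lipschitz functions of the samples and the frequency *)

(** The [l^1] norm is submultiplicative and directly comparable with the bounds on real and
    imaginary parts in [lebesgue_null]. *)
Definition norm1 (R : realType) (z : R[i]) : R :=
  `|complex.Re z| + `|complex.Im z|.

Lemma norm1_ge0 (R : realType) (z : R[i]) : 0 <= norm1 z.
Proof. by rewrite addr_ge0. Qed.

Lemma norm1D (R : realType) (z w : R[i]) : norm1 (z + w) <= norm1 z + norm1 w.
Proof.
by case: z w => [a b] [c e]; rewrite /norm1 /= addrACA lerD// ler_normD.
Qed.

Lemma norm1M (R : realType) (z w : R[i]) : norm1 (z * w) <= norm1 z * norm1 w.
Proof.
case: z w => [a b] [c e]; rewrite /norm1 /=.
apply: (@le_trans _ _ ((`|a * c| + `|b * e|) + (`|a * e| + `|b * c|))).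
  by rewrite lerD// ?ler_normD// (le_trans (ler_normB _ _)).
by rewrite !normrM; lra.
Qed.

Lemma norm1_le2 (R : realType) (z : R[i]) (e : R) :
  `|complex.Re z| <= e -> `|complex.Im z| <= e -> norm1 z <= 2 * e.
Proof. by rewrite /norm1; lra. Qed.

(* [om] is unrestricted: the coefficients are trigonometric in [om]. *)
Definition bounded_lip (R : realType) (I : Type) (F : (I -> R[i]) -> R -> R[i]) :=
  forall M : R, exists B : R, [/\ 0 <= B,
    forall x om, (forall i, norm1 (x i) <= M) -> norm1 (F x om) <= B &
    forall x y om om' e,
      (forall i, norm1 (x i) <= M) -> (forall i, norm1 (y i) <= M) ->
      (forall i, norm1 (x i - y i) <= e) -> `|om - om'| <= e ->
      norm1 (F x om - F y om') <= B * e].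

Lemma bounded_lip_ext (R : realType) (I : Type) (F G : (I -> R[i]) -> R -> R[i]) :
  (forall x om, F x om = G x om) -> bounded_lip F -> bounded_lip G.
Proof.
move=> FG bF M; have [B [B0 b l]] := bF M; exists B; split=> // [x om|x y om om' e].
  by rewrite -FG; exact: b.
by rewrite -!FG; exact: l.
Qed.

Lemma bounded_lip_cst (R : realType) (I : Type) (a : R[i]) :
  bounded_lip (fun (x : I -> R[i]) om => a).
Proof.
move=> M; exists (norm1 a); split=> //; first exact: norm1_ge0.
move=> x y om om' e _ _ _ e0; rewrite subrr /norm1/= normr0 addr0.
by rewrite mulr_ge0 ?norm1_ge0// (le_trans _ e0).
Qed.

Lemma bounded_lip_coord (R : realType) (I : Type) (i : I) :
  bounded_lip (fun (x : I -> R[i]) om => x i).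
Proof.
move=> M; exists (Num.max 1 M); split=> [|x om xM|x y om om' e xM yM exy eo].
- by rewrite le_max ler01.
- by rewrite le_max xM orbT.
- rewrite (le_trans (exy i))// ler_peMl ?le_max ?lexx//.
  by rewrite (le_trans _ eo).
Qed.

Lemma bounded_lipD (R : realType) (I : Type) (F G : (I -> R[i]) -> R -> R[i]) :
  bounded_lip F -> bounded_lip G -> bounded_lip (fun x om => F x om + G x om).
Proof.
move=> bF bG M; have [B [B0 b l]] := bF M; have [B' [B'0 b' l']] := bG M.
exists (B + B'); split=> [|x om xM|x y om om' e xM yM exy eo].
- exact: addr_ge0.
- by rewrite (le_trans (norm1D _ _))// lerD ?b ?b'.
- rewrite opprD addrACA (le_trans (norm1D _ _))// mulrDl lerD//.
    exact: l.
  exact: l'.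
Qed.

(** A difference of products pairs the Lipschitz bound of one factor with the size of the other,
    which is why [bounded_lip] records both. *)
Lemma bounded_lipM (R : realType) (I : Type) (F G : (I -> R[i]) -> R -> R[i]) :
  bounded_lip F -> bounded_lip G -> bounded_lip (fun x om => F x om * G x om).
Proof.
move=> bF bG M; have [B [B0 b l]] := bF M; have [B' [B'0 b' l']] := bG M.
exists (B * B' *+ 2); split=> [|x om xM|x y om om' e xM yM exy eo].
- by rewrite mulrn_wge0// mulr_ge0.
- rewrite (le_trans (norm1M _ _))// (@le_trans _ _ (B * B'))//.
    by rewrite ler_pM ?norm1_ge0 ?b ?b'.
  by rewrite mulr2n lerDl mulr_ge0.
- have -> : F x om * G x om - F y om' * G y om' =
     (F x om - F y om') * G x om + F y om' * (G x om - G y om') by ring.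
  rewrite (le_trans (norm1D _ _))// mulr2n [leRHS]mulrDl lerD//.
    rewrite (le_trans (norm1M _ _))// mulrAC ler_pM ?norm1_ge0 ?b'//.
    exact: l.
  rewrite (le_trans (norm1M _ _))// -mulrA ler_pM ?norm1_ge0 ?b//.
  exact: l'.
Qed.

Lemma bounded_lip_sum (R : realType) (I : Type) (J : Type) (r : seq J) (Q : pred J)
    (F : J -> (I -> R[i]) -> R -> R[i]) :
  (forall j, Q j -> bounded_lip (F j)) ->
  bounded_lip (fun x om => \sum_(j <- r | Q j) F j x om).
Proof.
move=> bF; elim: r => [|j r IHr].
  by apply: bounded_lip_ext (@bounded_lip_cst _ _ 0) => x om; rewrite big_nil.
case Qj : (Q j); last first.
  by apply: bounded_lip_ext IHr => x om; rewrite big_cons Qj.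
apply: bounded_lip_ext (bounded_lipD (bF _ Qj) IHr) => x om.
by rewrite big_cons Qj.
Qed.

Lemma bounded_lip_prod (R : realType) (I : Type) (J : Type) (r : seq J) (Q : pred J)
    (F : J -> (I -> R[i]) -> R -> R[i]) :
  (forall j, Q j -> bounded_lip (F j)) ->
  bounded_lip (fun x om => \prod_(j <- r | Q j) F j x om).
Proof.
move=> bF; elim: r => [|j r IHr].
  by apply: bounded_lip_ext (@bounded_lip_cst _ _ 1) => x om; rewrite big_nil.
case Qj : (Q j); last first.
  by apply: bounded_lip_ext IHr => x om; rewrite big_cons Qj.
apply: bounded_lip_ext (bounded_lipM (bF _ Qj) IHr) => x om.
by rewrite big_cons Qj.
Qed.

Lemma bounded_lip_det (R : realType) (I : Type) (n : nat)
    (A : 'I_n -> 'I_n -> (I -> R[i]) -> R -> R[i]) :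
  (forall i j, bounded_lip (A i j)) ->
  bounded_lip (fun x om => \det (\matrix_(i, j) A i j x om)).
Proof.
move=> bA.
apply: (bounded_lip_ext (F := fun x om =>
  \sum_(s : 'S_n) (-1) ^+ s * \prod_i A i (s i) x om)).
  by move=> x om; apply: eq_bigr => s _; congr (_ * _); apply: eq_bigr => i _; rewrite mxE.
apply: bounded_lip_sum => s _; apply: bounded_lipM; first exact: bounded_lip_cst.
exact: bounded_lip_prod.
Qed.

Lemma cos_lip (R : realType) (a b : R) : `|cos a - cos b| <= `|a - b|.
Proof.
wlog ab : a b / b <= a.
  move=> H; case: (leP b a) => [/H//|/ltW/H].
  by rewrite distrC [leRHS]distrC.
have [|c _ ->] := @MVT_segment R cos (fun x => - sin x) b a ab.
- by apply: continuous_subspaceT => x; exact: continuous_cos.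
- by rewrite normrM normrN ler_piMl// sin_max.
Qed.

Lemma sin_lip (R : realType) (a b : R) : `|sin a - sin b| <= `|a - b|.
Proof.
wlog ab : a b / b <= a.
  move=> H; case: (leP b a) => [/H//|/ltW/H].
  by rewrite distrC [leRHS]distrC.
have [|c _ ->] := @MVT_segment R sin cos b a ab.
- by apply: continuous_subspaceT => x; exact: continuous_sin.
- by rewrite normrM ler_piMl// cos_max.
Qed.

Lemma bounded_lip_expi (R : realType) (I : Type) (c k : R) :
  bounded_lip (fun (x : I -> R[i]) om => expi (c + k * om)).
Proof.
move=> M; exists (2 + `|k| *+ 2); split=> [|x om _|x y om om' e _ _ _ oe].
- by rewrite addr_ge0// mulrn_wge0.
- have := cos_max (c + k * om); have := sin_max (c + k * om).
  by rewrite /norm1/=; have := normr_ge0 k; lra.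
- rewrite /norm1 /expi /=.
  have := cos_lip (c + k * om) (c + k * om').
  have := sin_lip (c + k * om) (c + k * om').
  have -> : c + k * om - (c + k * om') = k * (om - om') by ring.
  have : `|k * (om - om')| <= `|k| * e by rewrite normrM ler_wpM2l.
  by have := normr_ge0 (om - om'); nra.
Qed.

(** * Matrices with generic pivots *)

Definition upd (I : eqType) (T : Type) (x : I -> T) (j : I) (c : T) : I -> T :=
  fun i => if i == j then c else x i.

(* On the locus in question [x j] is a Lipschitz function of [om] and of the other
   coordinates, and trading the complex coordinate [x j] for the real [om] lowers
   the real dimension by one. *)
Lemma lebesgue_null_affine_root (R : realType) (I : finType) (j : I)
    (D Q : (I -> R[i]) -> R -> R[i]) :
  bounded_lip D ->
  (forall x om c, D (upd x j c) om = D x om + (c - x j) * Q x om) ->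
  lebesgue_null [set x | exists om, D x om = 0 /\ Q x om <> 0]%classic.
Proof.
move=> lD affD; have I0 : (0 < #|I|)%N by apply/card_gt0P; exists j.
(* Uniform Lipschitz constants need bounds on [om], the samples and the inverse slope, so the locus
   is exhausted by bounded pieces. *)
pose W (M : nat) x om := [/\ `|om| <= M%:R, forall i, norm1 (x i) <= M%:R,
  D x om = 0, Q x om <> 0 & norm1 (Q x om)^-1 <= M%:R].
apply: (@lebesgue_null_sub _ _ _ (\bigcup_M [set x | exists om, W M x om])%classic).
  move=> x [om [Dx Qx]].
  pose b := `|om| + \sum_i norm1 (x i) + norm1 (Q x om)^-1.
  have s0 i : 0 <= norm1 (x i) by exact: norm1_ge0.
  have b1 : b <= (Num.truncn b).+1%:R by rewrite ltW// truncnS_gt.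
  have sx : 0 <= \sum_i norm1 (x i) by exact: sumr_ge0.
  have Q0 := norm1_ge0 (Q x om)^-1; have om0 := normr_ge0 om.
  exists (Num.truncn b).+1 => //; exists om; split=> // [|i|].
  - by rewrite (le_trans _ b1)// /b; lra.
  - rewrite (le_trans _ b1)// /b (bigD1 i)//=.
    have : 0 <= \sum_(k | k != i) norm1 (x k) by exact: sumr_ge0.
    by lra.
  - by rewrite (le_trans _ b1)// /b; lra.
apply: lebesgue_null_bigcup => // M.
(* The chosen frequency may jump with [x]; as it is itself a coordinate of [phi], points with close
   images have close frequencies. *)
pose th x := xget 0 [set om | W M x om]%classic.
have thP x : (exists om, W M x om) -> W M x (th x) by exact: xgetPex.
(* The pair [(i, b)] names a real coordinate of [x i]; at [j] one slot is dropped and the other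
   holds the frequency. *)
pose phi x (p : {p : I * bool | p != (j, false)}) : R :=
  if (val p).1 == j then th x else
  if (val p).2 then complex.Re (x (val p).1) else complex.Im (x (val p).1).
have [B [B0 _ lB]] := lD M%:R.
have BM0 : 0 <= M%:R * B by rewrite mulr_ge0.
(* The term [2 * (M%:R * B)] serves coordinate [j]; the extra [2] covers the other coordinates and
   keeps the constant positive. *)
apply: (@lebesgue_null_lipschitz_image _ _ _ _ phi M (2 * (M%:R * B) + 2)).
- rewrite card_sig (cardC1 (j, false)) card_prod card_bool mulnC.
  by rewrite prednK ?leqnn// muln_gt0.
- by rewrite ltr_wpDl// mulr_ge0.
- move=> x p /thP [om xM _ _ _]; rewrite /phi; case: ifP => // _.
  move: (xM (val p).1); rewrite /norm1.
  have := normr_ge0 (complex.Re (x (val p).1)).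
  have := normr_ge0 (complex.Im (x (val p).1)).
  by case: ifP => _; lra.
move=> x y e /thP [omx xM Dx Qx iQx] /thP [_ yM Dy _ _] e0 xy.
have thxy : `|th x - th y| <= e.
  have jt : (j, true) != (j, false) by rewrite xpair_eqE andbF.
  by have := xy (Sub (j, true) jt); rewrite /phi SubK /= eqxx.
have offj i : i != j -> `|complex.Re (x i - y i)| <= e /\ `|complex.Im (x i - y i)| <= e.
  move=> ij; have it b : (i, b) != (j, false) by rewrite xpair_eqE (negPf ij).
  have := xy (Sub (i, true) (it true)); have := xy (Sub (i, false) (it false)).
  by rewrite /phi !SubK /= (negPf ij); case: (x i) (y i) => [a b] [c d].
have atj : norm1 (x j - y j) <= 2 * (M%:R * B) * e.
  (* Moving only coordinate [j] of [x] to [y j] gives a point near the root [y]. By affinity the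
     small value of [D] there is [(y j - x j) * Q x (th x)], and the inverse slope is bounded. *)
  have : norm1 (D (upd x j (y j)) (th x) - D y (th y)) <= B * (2 * e).
    apply: lB => [i|//|i|]; rewrite ?/upd.
    - by case: eqP.
    - case: eqP => [->|/eqP/offj[? ?]]; last exact: norm1_le2.
      by rewrite subrr /norm1/= !normr0 addr0 mulr_ge0.
    - by rewrite (le_trans thxy)//; lra.
  rewrite affD Dx Dy add0r subr0 => H.
  have -> : x j - y j = ((y j - x j) * Q x (th x)) * - (Q x (th x))^-1.
    by field; apply/eqP.
  apply: le_trans (norm1M _ _) _.
  have -> : norm1 (- (Q x (th x))^-1) = norm1 (Q x (th x))^-1.
    by case: (_^-1) => [a b]; rewrite /norm1/= !normrN.
  rewrite mulrC (_ : _ * e = M%:R * (B * (2 * e))); last by ring.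
  by rewrite ler_pM// norm1_ge0.
move=> i; have [->|/offj[re im]] := eqVneq i j.
  move: atj; rewrite /norm1.
  have := normr_ge0 (complex.Re (x j - y j)).
  have := normr_ge0 (complex.Im (x j - y j)).
  by move=> ? ? ?; split; lra.
have : 0 <= (2 * (M%:R * B)) * e by rewrite mulr_ge0// mulr_ge0.
by split; lra.
Qed.

(** The determinant is linear in row [r]. The identity row and column of [B] make its determinant
    the minor of [A] off [r], while the size stays [n]. *)
Lemma det_entry_affine (R : comNzRingType) (n : nat) (A A' B : 'M[R]_n) (r : 'I_n) (c : R) :
  (forall i j, A' i j = A i j + (if (i == r) && (j == r) then c else 0)) ->
  (forall i j, B i j = if (i == r) || (j == r) then (i == j)%:R else A i j) ->
  \det A' = \det A + c * \det B.
Proof.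
move=> HA' HB.
pose B' : 'M[R]_n := \matrix_(i, j) if i == r then (i == j)%:R else A i j.
have -> : \det B = \det B'.
  have ex (E : 'M[R]_n) : (forall j, E r j = (r == j)%:R) -> \det E = cofactor E r r.
    move=> HE; rewrite (expand_det_row _ r) (bigD1 r)//= HE eqxx mul1r big1 ?addr0//.
    by move=> j jr; rewrite HE eq_sym (negPf jr) mul0r.
  rewrite !ex; [|by move=> j; rewrite mxE eqxx|by move=> j; rewrite HB eqxx].
  rewrite /cofactor; congr (_ * \det _); apply/matrixP => i j.
  by rewrite !mxE HB !(eq_sym _ r) !(negPf (neq_lift _ _)).
rewrite -[\det A]mul1r; apply: (determinant_multilinear (i0 := r)).
- apply/rowP => j; rewrite !mxE HA' !eqxx/= mul1r; congr (_ + _).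
  by rewrite [r == j]eq_sym; case: ifP => _; rewrite ?mulr1 ?mulr0.
- apply/matrixP => i j; rewrite !mxE HA' [_ == r]eq_sym (negPf (neq_lift _ _)) /=.
  by rewrite addr0.
- apply/matrixP => i j; rewrite !mxE HA' [_ == r]eq_sym (negPf (neq_lift _ _)) /=.
  by rewrite addr0.
Qed.

Lemma lebesgue_null0 (R : realType) (I : finType) :
  (0 < #|I|)%N -> lebesgue_null (set0 : set (I -> R[i])).
Proof.
move=> I0; apply: lebesgue_null_countable_cover => // e e0.
exists void, (fun=> fun=> 0), (fun=> 1); split=> // -[|[]//] _.
by rewrite big_nil ltW.
Qed.

(* The pivots [(j, j)] are peeled off by decreasing rank: the determinant of the
   block of rank [<= rank j] is affine in the variable [v j], which occurs in
   this block at [(j, j)] only, and its slope is [mu j] times the determinant of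
   the block of rank [< rank j]. *)
Lemma lebesgue_null_singular_triangular (R : realType) (I J : finType)
    (M : J -> J -> (I -> R[i]) -> R -> R[i]) (v : J -> I) (mu : J -> R -> R[i])
    (rank : J -> nat) :
  (0 < #|I|)%N -> injective rank -> (forall i j, bounded_lip (M i j)) ->
  (forall j om, mu j om != 0) ->
  (forall j x om c,
    M j j (upd x (v j) c) om = M j j x om + (c - x (v j)) * mu j om) ->
  (forall j i k x om c, (rank i <= rank j)%N -> (rank k <= rank j)%N ->
    (i, k) != (j, j) -> M i k (upd x (v j) c) om = M i k x om) ->
  lebesgue_null [set x | exists om (a : J -> R[i]),
    (forall i, \sum_j M i j x om * a j = 0) /\ exists j, a j <> 0]%classic.
Proof.
move=> I0 rank_inj lM mu0 Mdiag Moff.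
(* Padding by the identity keeps all blocks at size [#|J|], so [det_entry_affine] can compare
   consecutive determinants. *)
pose E m i j x om := if (rank i < m)%N && (rank j < m)%N then M i j x om
                     else (i == j)%:R.
pose D m x om := \det (\matrix_(i < #|J|, j < #|J|)
  E m (enum_val i) (enum_val j) x om).
have lD m : bounded_lip (D m).
  apply: (bounded_lip_det (A := fun i j => E m (enum_val i) (enum_val j))) => i j.
  by rewrite /E; case: (_ && _); [exact: lM|exact: bounded_lip_cst].
have nD m : lebesgue_null [set x | exists om, D m x om = 0]%classic.
  elim: m => [|m IHm].
    apply: lebesgue_null_sub _ (lebesgue_null0 I0) => x [om] /eqP; rewrite /D.
    rewrite (_ : \matrix_(i, j) _ = 1%:M) ?det1 ?oner_eq0//.
    by apply/matrixP => i j; rewrite !mxE /E ltn0 (inj_eq enum_val_inj).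
  have [[j jm]|noj] := pselect (exists j, rank j = m); last first.
    apply: lebesgue_null_sub _ IHm => x [om Dx]; exists om; rewrite -Dx /D; congr (\det _).
    apply/matrixP => i k; rewrite !mxE /E !ltnS !(leq_eqVlt (rank _)).
    have nm l : (rank l == m) = false by apply/eqP => H; apply: noj; exists l.
    by rewrite !nm.
  suff step : lebesgue_null
      [set x | exists om, D m.+1 x om = 0 /\ mu j om * D m x om <> 0]%classic.
    apply: lebesgue_null_sub _ (lebesgue_nullU I0 step IHm) => x [om Dx].
    have [Dm|Dm] := eqVneq (D m x om) 0; [by right; exists om|].
    by left; exists om; split=> //; apply/eqP; rewrite mulf_neq0.
  apply: (@lebesgue_null_affine_root _ _ (v j) _ _ (lD _)) => x om c; rewrite mulrA /D.
  apply: (det_entry_affine (r := enum_rank j)) => i k; rewrite !mxE.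
    rewrite -!(can2_eq (@enum_valK _) (@enum_rankK _)).
    move: (enum_val i) (enum_val k) => {}i {}k; rewrite /E !ltnS.
    have [->|ij] := eqVneq i j.
      have [->|kj] := eqVneq k j; first by rewrite jm !leqnn Mdiag.
      rewrite addr0; case: ifP => // /andP[_ km].
      by apply: Moff; rewrite ?jm// xpair_eqE (negPf kj) andbF.
    rewrite addr0; case: ifP => // /andP[im km].
    by apply: Moff; rewrite ?jm// xpair_eqE (negPf ij).
  rewrite -!(can2_eq (@enum_valK _) (@enum_rankK _)) -(inj_eq enum_val_inj).
  move: (enum_val i) (enum_val k) => {}i {}k; rewrite /E !ltnS -jm.
  have [->|ij] := eqVneq i j; first by rewrite ltnn.
  have [->|kj] := eqVneq k j; first by rewrite ltnn andbF.
  by rewrite !(leq_eqVlt (rank _) (rank j)) !(inj_eq rank_inj) (negPf ij) (negPf kj).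
apply: lebesgue_null_sub _ (nD (\max_j rank j).+1) => x [om [a [Ma [j aj]]]]; exists om.
apply: contra_notP aj => /eqP Dx.
have U : \matrix_(i < #|J|, k < #|J|) M (enum_val i) (enum_val k) x om \in unitmx.
  rewrite unitmxE unitfE; move: Dx; rewrite /D; congr (\det _ != 0).
  by apply/matrixP => i k; rewrite !mxE /E !ltnS !leq_bigmax.
have /matrixP/(_ (enum_rank j) 0) :
    (\col_(k < #|J|) a (enum_val k) : 'cV[R[i]]_#|J|) = 0.
  rewrite -[LHS](mulKmx U) [X in _ *m X](_ : _ = 0) ?mulmx0//.
  apply/matrixP => i k; rewrite !mxE -[RHS](Ma (enum_val i)).
  rewrite (reindex (fun k : 'I_#|J| => enum_val k)) /=; last first.
    by exists enum_rank => l _; rewrite ?enum_valK ?enum_rankK.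
  by apply: eq_bigr => l _; rewrite !mxE.
by rewrite !mxE enum_rankK.
Qed.

(** * The linear system of a zero-cost filter *)

Lemma expiD (R : realType) (a b : R) : expi (a + b) = expi a * expi b.
Proof. by rewrite /expi cosD sinD; apply/eqP; rewrite eq_complex/= eqxx addrC/= eqxx. Qed.

Lemma expi0 (R : realType) : expi (0 : R) = 1.
Proof. by rewrite /expi cos0 sin0. Qed.

Lemma expiNK (R : realType) (a : R) : expi (- a) * expi a = 1.
Proof. by rewrite -expiD addNr expi0. Qed.

Lemma expi_neq0 (R : realType) (a : R) : expi a != 0.
Proof.
apply/eqP => a0; have /eqP := expiNK a.
by rewrite a0 mulr0 eq_sym oner_eq0.
Qed.

(** From [cos (2 pi a) = 1] follows [sin (pi a) = 0]; subtracting the floor of a non-integer [a]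
    would put a zero of sine strictly between [0] and [pi]. *)
Lemma expi_2pi_eq1 (R : realType) (a : R) :
  expi (2 * pi * a) = 1 -> exists z : int, a = z%:~R.
Proof.
move=> /(congr1 (@complex.Re R)) /=.
have -> : 2 * pi * a = (pi * a) *+ 2 by rewrite -mulr_natr; ring.
rewrite cos_mulr2n => c1.
have /eqP : sin (pi * a) ^+ 2 = 0 by have := cos2Dsin2 (pi * a); lra.
rewrite sqrf_eq0 => /eqP s0; exists (Num.floor a); apply/eqP.
have /andP[fl fu] := floor_itv a.
rewrite eq_le fl andbT leNgt; apply/negP => lt_fa.
pose f := a - (Num.floor a)%:~R.
have fpi : 0 < pi * f < pi.
  have pi0 := @pi_gt0 R; rewrite pmulr_rgt0// subr_gt0 lt_fa/=.
  by rewrite gtr_pMr// /f; move: fu; rewrite intrD; lra.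
have := sin_gt0_pi fpi.
have -> : pi * f = pi * a + pi * (- Num.floor a)%:~R by rewrite mulrNz mulrDr.
suff -> : forall z : int, sin (pi * a + pi * z%:~R) = 0 by rewrite ltxx.
have step (x : R) (n : nat) : sin x = 0 -> sin (x + pi * n%:R) = 0.
  move=> x0; elim: n => [|n IHn]; first by rewrite mulr0 addr0.
  by rewrite -natr1 mulrDr mulr1 addrA sinDpi IHn oppr0.
case=> n; first exact: step.
rewrite NegzE mulrNz mulrN; apply: oppr_inj; rewrite oppr0 -sinN opprD opprK.
by apply: step; rewrite sinN s0 oppr0.
Qed.

(** * Phases and pivots of the sample matrix *)

Definition phase (R : realType) (a : R) (n : nat) : R[i] := expi (2 * pi * a * n%:R).

Lemma phaseE (R : realType) (a : R) (n : nat) : phase a n = phase a 1 ^+ n.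
Proof.
elim: n => [|n IHn]; first by rewrite /phase mulr0 expi0.
by rewrite exprS -IHn /phase -expiD -natr1; congr expi; ring.
Qed.

Lemma bounded_lip_phase (R : realType) (I : Type) (c k : R) (n : nat) :
  bounded_lip (fun (x : I -> R[i]) om => phase (c + k * om) n).
Proof.
apply: bounded_lip_ext (@bounded_lip_expi R I (2 * pi * c * n%:R) (2 * pi * k * n%:R)).
by move=> x om; rewrite /phase; congr expi; ring.
Qed.

(* The effective signal taps [Some (inl l)], the effective jammer taps
   [Some (inr (k, l))], and [None] for the frequency error. *)
Definition unknown (K L : nat) : finType := option ('I_L + 'I_K * 'I_L)%type.

(** Rows count from [0], and the pivots fill rows [0] to [K.+1 * L]. Column [None], whose
    coefficient vanishes in row [tau], takes row [tau.+1] and shifts the later taps by one. *)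
Definition pivot_row (K L tau : nat) (j : unknown K L) : nat :=
  match j with
  | None => tau.+1
  | Some (inl l) => if (l <= tau)%N then l : nat else l.+1
  | Some (inr (k, l)) => (L.+1 + k * L + l)%N
  end.

(** Decreasing rank removes the jammers, last one first, then the signal taps past [tau] from the
    top, then taps [0] to [tau] upwards, and finally [None]. *)
Definition pivot_rank (K L tau : nat) (j : unknown K L) : nat :=
  match j with
  | None => 0
  | Some (inl l) => if (l <= tau)%N then (tau.+1 - l)%N else l.+1
  | Some (inr (k, l)) => (L.+1 + k * L + l)%N
  end.

(* [(None, n)] stands for sample [n] of [s] and [(Some k, n)] for sample [n] of
   jammer [k], both counted from the start of the window in [sample_vector]. *)
Definition sample_pos (K L tau : nat) (t : nat) (j : unknown K L) : option 'I_K * nat :=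
  match j with
  | None => (None, t + tau)%N
  | Some (inl l) => (None, t + l)%N
  | Some (inr (k, l)) => (Some k, t + l)%N
  end.

Lemma pivot_row_lt (K L tau T : nat) (j : unknown K L) :
  (tau < L)%N -> (K.+1 * L < T)%N -> (pivot_row tau j < T)%N.
Proof.
move=> tauL; rewrite mulSn => LT.
case: j => [[l|[k l]]|] /=.
- by have := ltn_ord l; case: ifP => _; lia.
- have : (k.+1 * L <= K * L)%N by rewrite leq_mul2r ltn_ord orbT.
  by rewrite mulSn; have := ltn_ord l; lia.
- by lia.
Qed.

Lemma mulnD_ord_inj (K L : nat) (k k' : 'I_K) (l l' : 'I_L) :
  (k * L + l = k' * L + l')%N -> (k, l) = (k', l').
Proof.
move=> E; have L0 : (0 < L)%N by apply: leq_ltn_trans (ltn_ord l).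
have kk : k = k'.
  have := congr1 (fun n => n %/ L)%N E.
  rewrite !divnMDl// !divn_small ?ltn_ord// !addn0 => kk.
  by apply/val_inj.
by subst k'; congr pair; apply/val_inj/eqP; rewrite -(eqn_add2l (k * L)) E.
Qed.

Lemma pivot_rank_inj (K L tau : nat) :
  (tau < L)%N -> injective (@pivot_rank K L tau).
Proof.
move=> tauL [[l|[k l]]|] [[l'|[k' l']]|] //=;
  try (by have := ltn_ord l; case: ifP; lia);
  try (by have := ltn_ord l'; case: ifP; lia); try (by lia).
- move=> E; suff -> : l = l' by [].
  by apply/val_inj => /=; move: E; have := ltn_ord l; have := ltn_ord l'; do 2 case: ifP; lia.
- by rewrite -!addnA => /addnI/mulnD_ord_inj->.
Qed.

(** Within its block, the pivot of a jammer tap or of a signal tap past [tau] carries the latest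
    sample of its process, that of a signal tap up to [tau] the earliest. The one coincidence is
    sample [2 tau] of [s], which row [tau] shows in the column of tap [tau] and in column [None]. *)
Lemma sample_pos_pivot (K L tau : nat) (i k j : unknown K L) :
  (tau < L)%N -> (pivot_rank tau i <= pivot_rank tau j)%N ->
  (pivot_rank tau k <= pivot_rank tau j)%N ->
  sample_pos tau (pivot_row tau i) k = sample_pos tau (pivot_row tau j) j ->
  (i, k) = (j, j) \/ k = None /\ pivot_row tau i = tau.
Proof.
move=> tauL.
case: j => [[lj|[kj lj]]|].
- have lL := ltn_ord lj.
  case: k => [[lk|[kk lk]]|] //= ri rk [E].
  + have kL := ltn_ord lk.
    case: i ri E => [[li|[ki li]]|] /= ri E; last 2 first.
    * by exfalso; move: ri; case: ifP; lia.
    * by exfalso; move: rk E; do 2 case: ifP; lia.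
    left; have [/val_inj<- /val_inj<-] : (li = lj :> nat) /\ (lk = lj :> nat).
      by move: ri rk E; do 3 case: ifP; lia.
    by [].
  + right; split=> //; move: ri E.
    case: i => [[li|[ki li]]|] /=; do 2?case: ifP; lia.
- case: k => [[lk|[kk lk]]|] //= ri rk [Ek E]; subst kk.
  left; have lkj : (lk <= lj)%N by move: rk; lia.
  move: i ri E => [[li|[ki li]]|] /=.
  + by have := ltn_ord li; case: ifP; lia.
  + move=> ri E; have elk : lk = lj by apply: val_inj => /=; lia.
    subst lk; have Er : (ki * L + li = kj * L + lj)%N by lia.
    by case: (mulnD_ord_inj Er) => -> ->.
  + by lia.
- move=> ri rk _; left; congr pair.
    by apply: (pivot_rank_inj tauL); apply/eqP; rewrite -leqn0.
  by apply: (pivot_rank_inj tauL); apply/eqP; rewrite -leqn0.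
Qed.

(* The factor [sum_(m < t) u ^ m - sum_(m < tau) u ^ m] in column [None], with
   [u = phase (df - om) 1], is [(u ^ t - u ^ tau) / (u - 1)] continued to [u = 1]:
   it vanishes in row [tau] and makes the system nonsingular at [om = df] too. *)
Definition entry_coef (R : realType) (K L tau : nat) (df : R) (t : nat)
    (j : unknown K L) (om : R) : R[i] :=
  match j with
  | None => \sum_(m < t) phase (df - om) m - \sum_(m < tau) phase (df - om) m
  | Some (inl l) => phase (df - om) (t + l).+1
  | Some (inr (k, l)) => phase (- om) (t + l).+1
  end.

Lemma bounded_lip_entry_coef (R : realType) (I : Type) (K L tau : nat) (df : R)
    (t : nat) (j : unknown K L) :
  bounded_lip (fun (x : I -> R[i]) om => entry_coef tau df t j om).
Proof.
have lphase n : bounded_lip (fun (x : I -> R[i]) om => phase (df - om) n).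
  apply: bounded_lip_ext (@bounded_lip_phase R I df (-1) n) => x om.
  by rewrite mulN1r.
case: j => [[l|[k l]]|] /=.
- exact: lphase.
- apply: bounded_lip_ext (@bounded_lip_phase R I 0 (-1) _) => x om.
  by rewrite add0r mulN1r.
- apply: (bounded_lip_ext (F := fun x om => \sum_(m < t) phase (df - om) m +
     -1 * \sum_(m < tau) phase (df - om) m)); first by move=> x om; rewrite mulN1r.
  apply: bounded_lipD; first by apply: bounded_lip_sum.
  by apply: bounded_lipM; [exact: bounded_lip_cst|exact: bounded_lip_sum].
Qed.

Lemma entry_coef_pivot_neq0 (R : realType) (K L tau : nat) (df : R)
    (j : unknown K L) (om : R) :
  entry_coef tau df (pivot_row tau j) j om != 0.
Proof.
case: j => [[l|[k l]]|] /=; try exact: expi_neq0.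
by rewrite big_ord_recr /= addrAC subrr add0r expi_neq0.
Qed.

(** A date outside the window is sent to [0] by [insubd], so injectivity holds only inside it. *)
Definition sample_index (n : nat) (n0 : (0 < n)%N) (K : nat) (p : option 'I_K * nat) :
    ('I_n + 'I_K * 'I_n)%type :=
  let t := insubd (Ordinal n0) p.2 in
  if p.1 is Some k then inr (k, t) else inl t.

Lemma sample_index_inj (n : nat) (n0 : (0 < n)%N) (K : nat) (p q : option 'I_K * nat) :
  (p.2 < n)%N -> (q.2 < n)%N -> sample_index n0 p = sample_index n0 q -> p = q.
Proof.
have insK t : (t < n)%N -> val (insubd (Ordinal n0) t) = t.
  by move=> tn; rewrite val_insubd tn.
case: p q => [[k|] t] [[k'|] t'] //= tn tn'; rewrite /sample_index /=.
  by case=> -> /(congr1 val); rewrite !insK// => ->.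
by case=> /(congr1 val); rewrite !insK// => ->.
Qed.

Lemma sample_pos_lt (K L tau t T : nat) (j : unknown K L) :
  (tau < L)%N -> (t < T)%N -> ((sample_pos tau t j).2 < T + L - 1)%N.
Proof.
move=> tauL tT; case: j => [[l|[k l]]|] /=; last by lia.
  by have := ltn_ord l; lia.
by have := ltn_ord l; lia.
Qed.

Lemma null_singular_system (R : realType) (K L T tau : nat) (df : R)
    (n0 : (0 < T + L - 1)%N) :
  (tau < L)%N -> (K.+1 * L < T)%N ->
  lebesgue_null [set x : 'I_(T + L - 1) + 'I_K * 'I_(T + L - 1) -> R[i] |
    exists om (a : unknown K L -> R[i]),
    (forall t, (t < T)%N ->
      \sum_j x (sample_index n0 (sample_pos tau t j)) * entry_coef tau df t j om * a j
      = 0) /\ exists j, a j <> 0]%classic.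
Proof.
move=> tauL LT.
have rT (j : unknown K L) : (pivot_row tau j < T)%N by exact: pivot_row_lt.
apply: (lebesgue_null_sub _ (@lebesgue_null_singular_triangular R _ (unknown K L)
  (fun i j x om => x (sample_index n0 (sample_pos tau (pivot_row tau i) j)) *
                   entry_coef tau df (pivot_row tau i) j om)
  (fun j => sample_index n0 (sample_pos tau (pivot_row tau j) j))
  (fun j om => entry_coef tau df (pivot_row tau j) j om) (@pivot_rank K L tau)
  _ _ _ _ _ _)).
- by move=> x [om [a [Ha a0]]]; exists om, a; split=> // i; exact: Ha.
- by apply/card_gt0P; exists (inl (Ordinal n0)).
- exact: pivot_rank_inj.
- move=> i j; apply: bounded_lipM; first exact: bounded_lip_coord.
  exact: bounded_lip_entry_coef.
- by move=> j om; exact: entry_coef_pivot_neq0.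
- by move=> j x om c; rewrite /upd eqxx -mulrDl addrC subrK.
(* In the coincidence left by [sample_pos_pivot], the coefficient of [None] in row [tau] is [0]. *)
- move=> j i k x om c ij kj /eqP nij; rewrite /upd; case: eqP => // /sample_index_inj.
  rewrite !sample_pos_lt// => /(_ isT isT) /(sample_pos_pivot tauL ij kj) [//|[-> ->]].
  by rewrite /= subrr !mulr0.
Qed.

(** * Zero-cost filters as solutions of the linear system *)

Lemma dotHD (R : realType) (n : nat) (w u v : 'cV[R[i]]_n) :
  dotH w (u + v) = dotH w u + dotH w v.
Proof. by rewrite /dotH mulmxDr mxE. Qed.

Lemma dotHZ (R : realType) (n : nat) (w u : 'cV[R[i]]_n) (c : R[i]) :
  dotH w (c *: u) = c * dotH w u.
Proof. by rewrite /dotH -scalemxAr mxE. Qed.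

Lemma dotH_sum (R : realType) (n K : nat) (w : 'cV[R[i]]_n) (u : 'I_K -> 'cV[R[i]]_n) :
  dotH w (\sum_k u k) = \sum_k dotH w (u k).
Proof. by rewrite /dotH mulmx_sumr summxE. Qed.

Lemma dotHC (R : realType) (n : nat) (u w : 'cV[R[i]]_n) :
  dotH u w = conjc (dotH w u).
Proof.
rewrite /dotH !mxE rmorph_sum; apply: eq_bigr => k _.
by rewrite !mxE rmorphM /= conjcK mulrC.
Qed.

Lemma cabs2_eq0 (R : realType) (z : R[i]) : cabs2 z = 0 -> z = 0.
Proof.
case: z => a b; rewrite /cabs2 /= => /eqP.
by rewrite paddr_eq0 ?sqr_ge0// !sqrf_eq0 => /andP[/eqP-> /eqP->].
Qed.

Lemma cabs2_ge0 (R : realType) (z : R[i]) : 0 <= cabs2 z.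
Proof. by rewrite addr_ge0 ?sqr_ge0. Qed.

Lemma costF_eq0 (R : realType) (N L T : nat) (s : int -> R[i])
    (y : int -> 'cV[R[i]]_N) (om : R) (w : 'I_L -> 'cV[R[i]]_N) :
  costF T s y om w = 0 -> forall t, (t < T)%N ->
  \sum_(l < L) expi (- (2 * pi * om * ((t.+1 + l)%N : int)%:~R)) *
      dotH (w l) (y ((t.+1 + l)%N : int)) = s (t.+1 : int).
Proof.
rewrite /costF => /eqP; rewrite psumr_eq0 => [/allP H t tT|t _]; last exact: cabs2_ge0.
have /implyP/(_ isT)/eqP/cabs2_eq0/eqP := H (Ordinal tT) (mem_index_enum _).
by rewrite subr_eq0 => /eqP/esym.
Qed.

Lemma filter_output (R : realType) (N K tau : nat) (df om : R) (h w : 'cV[R[i]]_N)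
    (g : 'I_K -> 'cV[R[i]]_N) (s : int -> R[i]) (ii : 'I_K -> int -> R[i]) (n : nat) :
  expi (- (2 * pi * om * (n : int)%:~R)) * dotH w (rx_signal tau df h g s ii (n : int)) =
  s ((n : int) - tau%:Z) * phase (df - om) n * dotH w h +
  \sum_k ii k (n : int) * phase (- om) n * dotH w (g k).
Proof.
have -> : phase (df - om) n = expi (- (2 * pi * om * (n : int)%:~R)) *
                              expi (2 * pi * df * (n : int)%:~R).
  by rewrite -expiD /phase; congr expi; rewrite -[_%:~R]/(n%:R); ring.
have -> : phase (- om) n = expi (- (2 * pi * om * (n : int)%:~R)).
  by rewrite /phase; congr expi; rewrite -[_%:~R]/(n%:R); ring.
rewrite /rx_signal dotHD dotHZ dotH_sum mulrDr mulr_sumr; congr (_ + _); first by ring.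
by apply: eq_bigr => k _; rewrite dotHZ; ring.
Qed.

(** The first column of a right inverse of the stacked rows, conjugated because [dotH] conjugates
    its first argument, serves as tap [tau]; the other taps are [0]. *)
Lemma exists_good_filter (R : realType) (N K L tau : nat) (h : 'cV[R[i]]_N)
    (g : 'I_K -> 'cV[R[i]]_N) :
  row_free (col_mx h^T (\matrix_(k < K, n < N) g k n 0)) ->
  exists w : 'I_L -> 'cV[R[i]]_N, good_filters tau h g w.
Proof.
move=> /row_freeP [B AB].
have hB : h^T *m B = row_mx 1%:M 0.
  by have := congr1 usubmx AB; rewrite mul_col_mx col_mxKu scalar_mx_block block_mxEv col_mxKu.
have gB : (\matrix_(k < K, n < N) g k n 0) *m B = row_mx 0 1%:M.
  by have := congr1 dsubmx AB; rewrite mul_col_mx col_mxKd scalar_mx_block block_mxEv col_mxKd.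
pose w0 : 'cV[R[i]]_N := map_mx conjc (col 0 (lsubmx B)).
have dotw0 (u : 'cV[R[i]]_N) : dotH u w0 = conjc ((u^T *m lsubmx B) 0 0).
  rewrite /dotH !mxE rmorph_sum; apply: eq_bigr => k _.
  by rewrite !mxE rmorphM.
have hw0 : dotH h w0 = 1.
  by rewrite dotw0 mulmx_lsub hB row_mxKl mxE eqxx rmorph1.
have gw0 k : dotH (g k) w0 = 0.
  rewrite dotw0 (_ : _ *m _ = row k (lsubmx ((\matrix_(k < K, n < N) g k n 0) *m B))).
    by rewrite gB row_mxKl !mxE rmorph0.
  rewrite -mulmx_lsub row_mul; congr (_ *m _).
  by apply/rowP => n; rewrite !mxE.
have dot0 (u : 'cV[R[i]]_N) : dotH u 0 = 0 by rewrite /dotH mulmx0 mxE.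
exists (fun l => if val l == tau then w0 else 0); split; [|split].
- by move=> l ->; rewrite eqxx.
- by move=> l /eqP/negPf->.
- by move=> k l; case: ifP.
Qed.

Lemma sum_unknown (R : zmodType) (K L : nat) (f : unknown K L -> R) :
  \sum_j f j = \sum_(l < L) f (Some (inl l)) +
     \sum_(l < L) \sum_(k < K) f (Some (inr (k, l))) + f None.
Proof.
rewrite (bigD1 None) //= addrC; congr (_ + _).
rewrite (reindex_omap Some id) /=; last by case.
under eq_bigl do rewrite eqxx.
rewrite big_sumType /=; congr (_ + _).
by rewrite exchange_big pair_big; apply: eq_bigr => -[].
Qed.

Lemma costF_good_filter (R : realType) (N K L T tau : nat) (df : R)
    (h : 'cV[R[i]]_N) (g : 'I_K -> 'cV[R[i]]_N) (s : int -> R[i])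
    (ii : 'I_K -> int -> R[i]) (w : 'I_L -> 'cV[R[i]]_N) :
  (tau < L)%N -> good_filters tau h g w ->
  costF T s (rx_signal tau df h g s ii) df w = 0.
Proof.
move=> tauL [w1 [w0 wg]]; apply: big1 => t _.
suff -> : \sum_(l < L) expi (- (2 * pi * df * ((t.+1 + l)%N : int)%:~R)) *
    dotH (w l) (rx_signal tau df h g s ii ((t.+1 + l)%N : int)) = s (t.+1 : int).
  by rewrite subrr /cabs2 /= expr0n addr0.
have ph0 n : phase (df - df) n = 1 by rewrite subrr /phase mulr0 mul0r expi0.
rewrite (bigD1 (Ordinal tauL)) //= big1 => [|l ltau]; rewrite filter_output big1.
- rewrite ph0 mulr1 dotHC w1// rmorph1 mulr1 PoszD addrK !addr0 //.
- by move=> k _; rewrite dotHC wg rmorph0 mulr0.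
- by rewrite dotHC w0 ?rmorph0 ?mulr0 ?addr0//; apply/eqP.
- by move=> k _; rewrite dotHC wg rmorph0 mulr0.
Qed.

Lemma good_filter_of_costF_eq0 (R : realType) (N K L T tau : nat) (df : R)
    (n0 : (0 < T + L - 1)%N) (h : 'cV[R[i]]_N) (g : 'I_K -> 'cV[R[i]]_N)
    (s : int -> R[i]) (ii : 'I_K -> int -> R[i]) (om : R) (w : 'I_L -> 'cV[R[i]]_N) :
  (tau < L)%N ->
  (forall a : unknown K L -> R[i],
    (forall t, (t < T)%N ->
      \sum_j @sample_vector R K L T tau s ii (sample_index n0 (sample_pos tau t j)) *
             entry_coef tau df t j om * a j = 0) -> forall j, a j = 0) ->
  costF T s (rx_signal tau df h g s ii) om w = 0 ->
  phase (df - om) 1 = 1 /\ good_filters tau h g w.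
Proof.
move=> tauL nonsing /costF_eq0 F0.
set u := phase (df - om) 1.
have u0 : u != 0 by exact: expi_neq0.
(* Scale the zero-cost equation by [u ^+ (tau + tau.+1)] and subtract the contribution
   [s t.+1 * u ^+ (t + tau.+1)] of [e_tau]. With this exponent the remainder contains the factor
   [u ^+ t - u ^+ tau], which [u - 1] divides, and becomes column [None]. *)
pose a (j : unknown K L) : R[i] := match j with
  | Some (inl l) => u ^+ (tau + tau.+1) * dotH (w l) h - (val l == tau)%:R
  | Some (inr (k, l)) => u ^+ (tau + tau.+1) * dotH (w l) (g k)
  | None => (u - 1) * u ^+ tau.+1
  end.
have Ea : forall j, a j = 0.
  apply: nonsing => t tT.
  have sE p : (p.2 < T + L - 1)%N -> @sample_vector R K L T tau s ii (sample_index n0 p) =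
      if p.1 is Some k then ii k (p.2.+1%:Z) else s (p.2.+1%:Z - tau%:Z).
    by case: p => [[k|] m] /= mT; rewrite /sample_index /= val_insubd mT.
  have geom n : (\sum_(m < n) phase (df - om) m) * (u - 1) = u ^+ n - 1.
    rewrite mulrC subrX1; congr (_ * _); apply: eq_bigr => m _.
    by rewrite phaseE.
  under eq_bigr do rewrite sE ?sample_pos_lt//.
  rewrite sum_unknown /=.
  have -> : s ((t + tau).+1%:Z - tau%:Z) = s t.+1 by rewrite -addSn PoszD addrK.
  have st : s t.+1 = \sum_(l < L) (
      s ((t.+1 + l)%N%:Z - tau%:Z) * phase (df - om) (t.+1 + l) * dotH (w l) h +
      \sum_(k < K) ii k (t.+1 + l)%N * phase (- om) (t.+1 + l) * dotH (w l) (g k)).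
    by rewrite -(F0 t tT); apply: eq_bigr => l _; rewrite filter_output.
  have -> : s t.+1 * (\sum_(m < t) phase (df - om) m - \sum_(m < tau) phase (df - om) m) *
        ((u - 1) * u ^+ tau.+1) =
     s t.+1 * u ^+ (t + tau.+1) - u ^+ (tau + tau.+1) * s t.+1.
    rewrite -mulrA [X in _ * X]mulrA mulrBl !geom !exprD; ring.
  rewrite [X in _ - _ * X]st.
  rewrite big_split /= mulrDr !mulr_sumr.
  under eq_bigr do rewrite mulrBr.
  rewrite sumrB.
  have -> : \sum_(l < L) s ((t + l).+1%:Z - tau%:Z) * phase (df - om) (t + l).+1 *
      (val l == tau)%:R = s t.+1 * u ^+ (t + tau.+1).
    rewrite (bigD1 (Ordinal tauL)) //= eqxx mulr1 big1 ?addr0 => [|l ltau].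
      by rewrite -addSn PoszD addrK phaseE addSnnS.
    by rewrite -[_ == tau]/(l == Ordinal tauL) (negPf ltau) mulr0.
  have -> : \sum_(l < L) s ((t + l).+1%:Z - tau%:Z) * phase (df - om) (t + l).+1 *
        (u ^+ (tau + tau.+1) * dotH (w l) h) =
      \sum_(l < L) u ^+ (tau + tau.+1) *
        (s ((t.+1 + l)%N%:Z - tau%:Z) * phase (df - om) (t.+1 + l) * dotH (w l) h).
    by apply: eq_bigr => l _; rewrite addSn; ring.
  have -> : \sum_(l < L) \sum_(k < K) ii k (t + l).+1 * phase (- om) (t + l).+1 *
        (u ^+ (tau + tau.+1) * dotH (w l) (g k)) =
      \sum_(l < L) u ^+ (tau + tau.+1) *
        (\sum_(k < K) ii k (t.+1 + l)%N * phase (- om) (t.+1 + l) * dotH (w l) (g k)).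
    apply: eq_bigr => l _; rewrite mulr_sumr addSn; apply: eq_bigr => k _; ring.
  ring.
(* Column [None] comes first: once [u = 1], the scaling disappears from the other unknowns. *)
have u1 : u = 1.
  have /eqP := Ea None; rewrite /a mulf_eq0 expf_eq0 /= (negPf u0) orbF.
  by rewrite subr_eq0 => /eqP.
split=> //; split; [|split].
- move=> l ltau; rewrite dotHC; have := Ea (Some (inl l)).
  rewrite /a u1 expr1n mul1r ltau eqxx => /eqP; rewrite subr_eq0 => /eqP->.
  exact: rmorph1.
- move=> l /eqP ltau; rewrite dotHC; have := Ea (Some (inl l)).
  by rewrite /a u1 expr1n mul1r (negPf ltau) subr0 => ->; exact: rmorph0.
- move=> k l; rewrite dotHC; have := Ea (Some (inr (k, l))).
  by rewrite /a u1 expr1n mul1r => ->; exact: rmorph0.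
Qed.

Theorem theorem1 (R : realType) (N K L T tau : nat) (df : R)
  (h : 'cV[R[i]]_N) (g : 'I_K -> 'cV[R[i]]_N) (Om : set R)
  (d : measure_display) (Sample : measurableType d) (P : probability Sample R)
  (s : Sample -> int -> R[i]) (ii : Sample -> 'I_K -> int -> R[i]) :
  (0 < N)%N -> (0 < K)%N -> (0 < L)%N -> (0 < T)%N ->
  (K.+1 <= N)%N ->
  (tau < L)%N ->
  row_free (col_mx h^T (\matrix_(k < K, n < N) g k n 0)) ->
  Om df ->
  (forall a b : R, Om a -> Om b -> a <> b -> forall z : int, a - b <> z%:~R) ->
  (* the relevant samples have a jointly continuous distribution:
     their law charges no Lebesgue-null set *)
  (forall Z, lebesgue_null Z ->
     exists B : set Sample, measurable B /\
       (forall o, Z (@sample_vector R K L T tau (s o) (ii o)) -> B o) /\ P B = 0%E) ->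
  (K.+1 * L < T)%N ->
  (* with probability one: *)
  exists B : set Sample, measurable B /\ P B = 0%E /\
    forall o, ~ B o ->
      let y := rx_signal tau df h g (s o) (ii o) in
      (forall om (w : 'I_L -> 'cV[R[i]]_N), Om om -> 0 <= costF T (s o) y om w) /\
      (exists om (w : 'I_L -> 'cV[R[i]]_N), Om om /\ costF T (s o) y om w = 0) /\
      (forall om (w : 'I_L -> 'cV[R[i]]_N), Om om -> costF T (s o) y om w = 0 ->
         om = df /\ good_filters tau h g w).
Proof.
move=> _ _ L0 _ _ tauL free Omdf Om_int cont LT.
have n0 : (0 < T + L - 1)%N by lia.
(* One exceptional event serves all frequencies, since [om] is quantified inside the null set. *)
have [B [mB [ZB PB]]] := cont _ (null_singular_system (R := R) df n0 tauL LT).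
exists B; split=> //; split=> // o nBo y; split; [|split].
- by move=> om w _; apply: sumr_ge0 => t _; exact: cabs2_ge0.
- have [w gw] := @exists_good_filter R N K L tau h g free.
  by exists df, w; split=> //; exact: costF_good_filter.
- move=> om w Omom cost0.
  have [|u1 gw] := @good_filter_of_costF_eq0 R N K L T tau df n0 h g (s o) (ii o) om w
    tauL _ cost0.
    move=> a Ha j; apply: contra_notP nBo => aj; apply: ZB.
    by exists om, a; split=> //; exists j.
  (* A unit phase only gives [om] modulo integers; the separation of [Om] removes the ambiguity. *)
  split=> //; have [z dfz] : exists z : int, df - om = z%:~R.
    by apply: expi_2pi_eq1; move: u1; rewrite /phase mulr1.
  by apply: contrapT => omdf; apply: (Om_int df om _ _ _ z) => // /esym.
Qed.
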